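(* Let $K$ be a field, $S=K[x_1,\ldots,x_n]$, $\mathbf c=(c_1,\ldots,c_n)$ an integer vector with all $c_i\ge 0$, and $\mathbf e=(1,\ldots,1)\in\mathbb Z^n$. Let $u=x_1^{a_1}\cdots x_n^{a_n}$ be a $\mathbf c$-bounded monomial in $S$ and $I=B^{\mathbf c}(u)$. Then for any positive integer $k$ \[ \operatorname{sat}(I^k)=\max\{\ell:\ \text{there exists } v\in G(B^{k\mathbf c}(u^k)) \text{ with } x_n^\ell\mid v \text{ and } \operatorname{Deg}(v/x_n^\ell)\leq k\mathbf c-\ell\mathbf e\}. \]
   Context: $\mathfrak m=(x_1,\ldots,x_n)$. For a monomial ideal $I$, $G(I)$ is its unique minimal set of monomial generators. For a monomial $u=x_1^{a_1}\cdots x_n^{a_n}$ put $\operatorname{Deg}(u)=(a_1,\ldots,a_n)$; integer vectors are compared componentwise. A monomial $u$ is $\mathbf b$-bounded if $\operatorname{Deg}(u)\le\mathbf b$. A monomial ideal $I$ is $\mathbf b$-bounded strongly stable if all $u\in G(I)$ are $\mathbf b$-bounded, and for all $u\in G(I)$ and all $i<j$ with $x_j\mid u$ for which $x_iu/x_j$ is $\mathbf b$-bounded, one has $x_iu/x_j\in I$. For a $\mathbf b$-bounded monomial $w$, $B^{\mathbf b}(w)$ is the smallest $\mathbf b$-bounded strongly stable ideal containing $w$. The saturation number of a graded ideal $I$ is $\operatorname{sat}(I)=\min\{k\ge 0: I:\mathfrak m^k=I:\mathfrak m^{k+1}\}$. *)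

(* Defs.v *)
From HB Require Import structures.
From mathcomp Require Import all_boot all_order all_algebra.
From mathcomp Require Import zify.
From mathcomp Require Export mpoly.
From Stdlib Require Import Classical.

Set Implicit Arguments.
Unset Strict Implicit.
Unset Printing Implicit Defensive.

Import Order.TTheory GRing.Theory Num.Theory.
Local Open Scope ring_scope.

Section Ideals.

Variable A : comNzRingType.

(* Ideals are Prop-valued subsets: membership is not decidable a priori, and
   the unit ideal must be allowed. *)
Implicit Types (I J X : A -> Prop) (f g : A).

Definition same_set I J : Prop := forall f, I f <-> J f.

Definition ideal_gen X : A -> Prop := fun f =>
  exists2 s : seq (A * A), (forall p, p \in s -> X p.2)
                         & f = \sum_(p <- s) p.1 * p.2.

Definition ideal_mul I J : A -> Prop :=
  ideal_gen (fun h => exists f g, [/\ I f, J g & h = f * g]).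

Fixpoint ideal_pow I (k : nat) : A -> Prop :=
  if k is k'.+1 then ideal_mul I (ideal_pow I k') else fun _ => True.

Definition ideal_colon I J : A -> Prop := fun f => forall g, J g -> I (f * g).

End Ideals.

Definition is_min (P : nat -> Prop) (m : nat) : Prop :=
  P m /\ forall k, P k -> (m <= k)%N.

Definition is_max (P : nat -> Prop) (m : nat) : Prop :=
  P m /\ forall k, P k -> (k <= m)%N.

Section Multidegrees.

Variable n : nat.

Implicit Types (u v m : 'X_{1..n}) (b : 'rV[int]_n).

Definition Deg u : 'rV[int]_n := \row_i (u i)%:Z.

Definition vle (x y : 'rV[int]_n) : Prop := forall i, x 0 i <= y 0 i.

Definition bounded b u : Prop := vle (Deg u) b.

Definition evec : 'rV[int]_n := const_mx 1.

End Multidegrees.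

Arguments evec n : clear implicits.

Section MonomialIdeals.

Variables (K : fieldType) (n : nat).

Local Notation S := {mpoly K[n]}.

Implicit Types (I : S -> Prop) (G M : 'X_{1..n} -> Prop) (u m : 'X_{1..n})
  (b : 'rV[int]_n).

Definition max_ideal : S -> Prop :=
  ideal_gen (fun f => exists i : 'I_n, f = 'X_i).

Definition is_sat I (s : nat) : Prop :=
  is_min (fun k => same_set (ideal_colon I (ideal_pow max_ideal k))
                            (ideal_colon I (ideal_pow max_ideal k.+1))) s.

Definition mon_gen M : S -> Prop :=
  ideal_gen (fun f => exists2 m, M m & f = 'X_[m]).

Definition monomial_ideal I : Prop := exists M, same_set I (mon_gen M).

Definition is_mingens I G : Prop :=
  same_set I (mon_gen G) /\
  forall M, (forall m, M m -> G m) -> same_set I (mon_gen M) ->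
            forall m, G m -> M m.

(* G(I); [is_mingens_minmon] and [is_mingens_unique] below show that
   there is exactly one minimal set of monomial generators of a monomial ideal I. *)
Definition mingens I : 'X_{1..n} -> Prop :=
  fun m => exists2 G, is_mingens I G & G m.

Definition strongly_stable b I : Prop :=
  [/\ monomial_ideal I,
      forall u, mingens I u -> bounded b u
    & forall u (i j : 'I_n), mingens I u -> (i < j)%N -> (U_(j) <= u)%MM ->
        bounded b (U_(i) + u - U_(j))%MM -> I 'X_[(U_(i) + u - U_(j))%MM]].

(* The smallest b-bounded strongly stable ideal containing w, obtained as the
   intersection of all of them; it is one of them by [strongly_stable_Bb]. *)
Definition Bb b (w : 'X_{1..n}) : S -> Prop :=
  fun f => forall I, strongly_stable b I -> I 'X_[w] -> I f.

End MonomialIdeals.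

Arguments Bb K {n} b w f.

Section Facts.

Variables (K : fieldType) (n : nat).

Local Notation S := {mpoly K[n]}.

Implicit Types (I : S -> Prop) (G M : 'X_{1..n} -> Prop) (u m : 'X_{1..n})
  (b : 'rV[int]_n).

Lemma mon_genP M (f : S) :
  mon_gen M f <-> forall m, m \in msupp f -> exists2 g, M g & (g <= m)%MM.
Proof.
split=> [[s Ms ->] m|Mf].
  elim: s Ms => [|p s IHs] Ms; first by rewrite big_nil msupp0 in_nil.
  rewrite big_cons => /msuppD_le; rewrite mem_cat => /orP[|]; last first.
    by apply: IHs => q qs; apply: Ms; rewrite in_cons qs orbT.
  have [g Mg ->] := Ms p (mem_head _ _).
  rewrite (perm_mem (msuppMX _ _)) => /mapP[k _ ->]; exists g => //.
  exact: lem_addr.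
have [s Ms Es] : exists2 s : seq (S * S),
    (forall p, p \in s -> exists2 m, M m & p.2 = 'X_[m])
    & \sum_(m <- msupp f) f@_m *: 'X_[m] = \sum_(p <- s) p.1 * p.2.
  elim: (msupp f) Mf => [|m r IHr] Mf.
    by exists [::] => //; rewrite !big_nil.
  have [|s Ms Es] := IHr; first by move=> k kr; apply: Mf; rewrite in_cons kr orbT.
  have [g Mg le_gm] := Mf m (mem_head _ _).
  exists ((f@_m *: 'X_[m - g], 'X_[g]) :: s) => [p|].
    by rewrite in_cons => /orP[/eqP->|/Ms//]; exists g.
  by rewrite !big_cons Es /= -scalerAl -mpolyXD submK.
by exists s => //; rewrite -Es -mpolyE.
Qed.

Lemma mon_genX M m : mon_gen M ('X_[m] : S) <-> exists2 g, M g & (g <= m)%MM.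
Proof.
rewrite mon_genP; split=> [|Mm k]; first by apply; rewrite msuppX mem_head.
by rewrite msuppX inE => /eqP->.
Qed.

Lemma monomial_idealP I :
  monomial_ideal I <->
  [/\ forall f, I f <-> forall m, m \in msupp f -> I 'X_[m]
    & forall g m, I 'X_[g] -> (g <= m)%MM -> I 'X_[m]].
Proof.
split=> [[M IM]|[If Iup]].
  split=> [f|g m /IM/mon_genX[k Mk le_kg] le_gm]; last first.
    by apply/IM/mon_genX; exists k => //; apply: lepm_trans le_gm.
  rewrite IM mon_genP; split=> Mf m /Mf; first by move/mon_genX/IM.
  by move/IM/mon_genX.
exists (fun m => I 'X_[m]) => f; rewrite If mon_genP; split=> Mf m mf.
  by exists m; [apply: Mf | apply: lepm_refl].
by have [g Ig /(Iup g m Ig)] := Mf m mf.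
Qed.

Definition minmon I m : Prop :=
  I 'X_[m] /\ forall g, I 'X_[g] -> (g <= m)%MM -> g = m.

Lemma minmon_ex I m : I 'X_[m] -> exists2 g, minmon I g & (g <= m)%MM.
Proof.
have [d] := ubnP (mdeg m); elim: d m => // d IHd m /ltnSE le_md Im.
have [[g [Ig le_gm neq_gm]]|min_m] :=
  classic (exists g, [/\ I 'X_[g], (g <= m)%MM & g <> m]); last first.
  exists m; [split=> // g Ig le_gm | exact: lepm_refl].
  by apply: NNPP => neq_gm; apply: min_m; exists g.
have lt_gm : (mdeg g < mdeg m)%N.
  rewrite -(submK le_gm) mdegD -[X in (X < _)%N]add0n ltn_add2r lt0n mdeg_eq0.
  by apply/eqP=> g0; apply: neq_gm; rewrite -(submK le_gm) g0 add0m.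
have [h min_h le_hg] := IHd g (leq_trans lt_gm le_md) Ig.
by exists h => //; apply: lepm_trans le_gm.
Qed.

Lemma is_mingens_minmon I : monomial_ideal I -> is_mingens I (minmon I).
Proof.
move=> /monomial_idealP[If Iup]; split=> [f|M sMI IM m [Im min_m]].
  rewrite If mon_genP; split=> Mf m mf; first exact/minmon_ex/Mf.
  by have [g [Ig _] le_gm] := Mf m mf; apply: Iup le_gm.
have /mon_genX[g Mg le_gm] := (IM _).1 Im.
by have [Ig _] := sMI g Mg; rewrite -(min_m g Ig le_gm).
Qed.

Lemma is_mingens_unique I G : is_mingens I G -> forall m, G m <-> minmon I m.
Proof.
move=> [IG minG].
have monI : monomial_ideal I by exists G.
have sG m : minmon I m -> G m.
  move=> [Im min_m]; have /mon_genX[g Gg le_gm] := (IG _).1 Im.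
  suff <- : g = m by [].
  by apply: min_m => //; apply/IG/mon_genX; exists g => //; apply: lepm_refl.
move=> m; split=> [|/sG//].
exact: minG sG (is_mingens_minmon monI).1 m.
Qed.

Lemma mingensE I : monomial_ideal I -> forall m, mingens I m <-> minmon I m.
Proof.
move=> monI m; split=> [[G IG Gm]|min_m].
  exact: (is_mingens_unique IG m).1.
by exists (minmon I) => //; apply: is_mingens_minmon.
Qed.

Lemma strongly_stable_move b I m (i j : 'I_n) : strongly_stable b I ->
  I 'X_[m] -> (i < j)%N -> (U_(j) <= m)%MM ->
  bounded b (U_(i) + m - U_(j))%MM -> I 'X_[(U_(i) + m - U_(j))%MM].
Proof.
move=> [monI bI stI] Im lt_ij le_jm bm.
have [_ Iup] := (monomial_idealP I).1 monI.
have neq_ij : (i == j) = false by rewrite -val_eqE ltn_eqF.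
have [g min_g /mnm_lepP le_gm] := minmon_ex Im.
have Gg : mingens I g by apply/mingensE.
have le_jm' : (0 < m j)%N.
  by move/mnm_lepP/(_ j): le_jm; rewrite mnm1E eqxx.
have [lt_gj|le_mg] := ltnP (g j) (m j).
  apply: (Iup g) => //; first by case: min_g.
  apply/mnm_lepP=> l; rewrite mnmBE mnmDE !mnm1E.
  have [<-|neq_jl] := eqVneq j l; first by rewrite neq_ij /= add0n; lia.
  by have := le_gm l; case: (i == l) => /=; lia.
have le_jg : (U_(j) <= g)%MM.
  apply/mnm_lepP=> l; rewrite mnm1E; case: eqP => //= <-.
  exact: leq_trans le_mg.
have le_gm' : (U_(i) + g - U_(j) <= U_(i) + m - U_(j))%MM.
  apply/mnm_lepP=> l; rewrite !mnmBE !mnmDE.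
  by apply: leq_sub2r; rewrite leq_add2l.
apply: Iup le_gm'; apply: stI => // l; apply: le_trans (bm l).
rewrite !mxE lez_nat !mnmBE !mnmDE.
by apply: leq_sub2r; rewrite leq_add2l.
Qed.

Lemma bounded_le b u m : (u <= m)%MM -> bounded b m -> bounded b u.
Proof.
move=> /mnm_lepP le_um bm i; apply: le_trans (bm i).
by rewrite !mxE lez_nat.
Qed.

Lemma strongly_stable_bounded b :
  strongly_stable b (mon_gen (bounded b) : S -> Prop).
Proof.
have monI : monomial_ideal (mon_gen (bounded b) : S -> Prop) by exists (bounded b).
split=> // [u|u i j _ _ _ bm]; last first.
  by apply/mon_genX; exists (U_(i) + u - U_(j))%MM => //; apply: lepm_refl.
move/(mingensE monI)=> [/mon_genX[g bg le_gu] min_u].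
suff <- : g = u by [].
by apply: min_u => //; apply/mon_genX; exists g => //; apply: lepm_refl.
Qed.

Lemma strongly_stable_Bb b w : bounded b w -> strongly_stable b (Bb K b w).
Proof.
move=> bw.
have monB : monomial_ideal (Bb K b w).
  apply/monomial_idealP; split=> [f|g m Bg le_gm I stI Iw]; last first.
    have [/monomial_idealP[_ Iup] _ _] := stI.
    exact: Iup (Bg I stI Iw) le_gm.
  split=> [Bf m mf I stI Iw|Bf I stI Iw];
    have [/monomial_idealP[If _] _ _] := stI.
    by move: (Bf I stI Iw) => /If; apply.
  by apply/If=> m mf; apply: Bf.
split=> // [u|u i j] /(mingensE monB)[Bu min_u]; last first.
  by move=> lt_ij le_ju bu I stI Iw; apply: (strongly_stable_move stI) => //; apply: Bu.
have bP I : strongly_stable b I -> I 'X_[w] ->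
    exists g, [/\ I 'X_[g], (g <= u)%MM & bounded b g].
  move=> stI Iw; have [monI bI _] := stI.
  have [g min_g le_gu] := minmon_ex (Bu I stI Iw).
  by exists g; split=> //; [case: min_g | apply/bI/mingensE].
pose v := [multinom minn (u i) (absz (b 0%R i)) | i < n].
have b_ge0 i : 0 <= b 0 i by apply: le_trans (bw i); rewrite mxE.
have b_v : bounded b v.
  by move=> i; rewrite mxE mnmE; have := b_ge0 i; case: (b 0 i) => // d _;
     rewrite lez_nat geq_minr.
suff <- : v = u by [].
apply: min_u => [I stI Iw|]; last by apply/mnm_lepP=> i; rewrite mnmE geq_minl.
have [g [Ig /mnm_lepP le_gu bg]] := bP I stI Iw.
have [/monomial_idealP[_ Iup] _ _] := stI.
apply: Iup Ig _; apply/mnm_lepP=> i; rewrite mnmE leq_min le_gu /=.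
by have := bg i; have := b_ge0 i; rewrite mxE; case: (b 0 i).
Qed.

Lemma Bb_least b w I :
  strongly_stable b I -> I 'X_[w] -> forall f, Bb K b w f -> I f.
Proof. by move=> stI Iw f; apply. Qed.

Lemma mem_Bb b w : Bb K b w 'X_[w].
Proof. by move=> I. Qed.

End Facts.

(* Main.v *)
Require Import Defs.
From mathcomp Require Import all_boot all_order all_algebra.
From mathcomp Require Import zify.
From mathcomp Require Import mpoly.
From Stdlib Require Import Classical.

(** The generators of [B^b(w)] are the b-bounded monomials of degree |w| whose
    prefix sums of exponents dominate those of w; hence a monomial m lies in
    [B^b(w)] iff the prefix sums of min(m, b) dominate those of w.  These
    exponent sets have the integer decomposition property, so
    [B^c(u)^k = B^(kc)(u^k)].  For an ideal J = [B^b(w)], a monomial m is in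
    J : 𝔪^j iff m * x_i^j is in J for every i, and comparing consecutive j shows
    that J : 𝔪^j and J : 𝔪^(j+1) differ iff some f of degree |w| - (j+1)
    satisfies f + (j+1)e <= b and dominates w in all proper prefixes, that is,
    iff f * x_n^(j+1) is a generator of the required shape. *)

Import GRing.Theory Num.Theory.
Local Open Scope ring_scope.

Set Implicit Arguments.
Unset Strict Implicit.
Unset Printing Implicit Defensive.

(** [P] need not be decidable, so the induction runs on the bound, and excluded middle settles
    whether the bound is attained. *)
Lemma bounded_pred_max (P : nat -> Prop) (B : nat) :
  P 0%N -> (forall l, P l -> (l <= B)%N) -> exists s, is_max P s.
Proof.
move=> P0; elim: B => [|B IHB] leB; first by exists 0%N.
have [PB|nPB] := classic (P B.+1); first by exists B.+1.
apply: IHB => l Pl; have := leB l Pl; rewrite leq_eqVlt ltnS.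
by case/orP=> // /eqP El; rewrite El in Pl.
Qed.

(** * Prefix sums of exponents and the dominance order *)

Section PrefixSums.

Context {n : nat}.

Implicit Types (m u v w p : 'X_{1..n}) (b : 'I_n -> nat) (l : nat).

Definition pref m l : nat := (\sum_(i < n | i < l) m i)%N.

Lemma pref0 m : pref m 0 = 0%N.
Proof. by rewrite /pref big_pred0. Qed.

Lemma prefS m (i : 'I_n) : pref m i.+1 = (pref m i + m i)%N.
Proof.
rewrite /pref (bigD1 i) //= addnC; congr (_ + _)%N.
by apply: eq_bigl => j; rewrite -val_eqE /=; lia.
Qed.

Lemma pref_mdeg m : pref m n = mdeg m.
Proof. by rewrite mdegE; apply: eq_bigl => i; rewrite ltn_ord. Qed.

Lemma prefD m v l : pref (m + v)%MM l = (pref m l + pref v l)%N.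
Proof. by rewrite /pref -big_split; apply: eq_bigr => i _; rewrite mnmDE. Qed.

Lemma prefU (i : 'I_n) l : pref U_(i)%MM l = (i < l)%N.
Proof.
rewrite /pref; have [lt_il|le_li] := ltnP i l.
  rewrite (bigD1 i) //= mnm1E eqxx big1 // => j /andP[_ /negPf nij].
  by rewrite mnm1E eq_sym nij.
rewrite big1 // => j lt_jl; rewrite mnm1E; case: eqP => // Eij.
by move: lt_jl; rewrite -Eij ltnNge le_li.
Qed.

Lemma prefMn m k l : pref (m *+ k)%MM l = (k * pref m l)%N.
Proof. by rewrite /pref big_distrr; apply: eq_bigr => i _; rewrite mulmnE mulnC. Qed.

Lemma leq_pref m v l : (forall i, m i <= v i)%N -> (pref m l <= pref v l)%N.
Proof. by move=> le_mv; apply: leq_sum. Qed.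

Definition mnm_of_pref (F : nat -> nat) : 'X_{1..n} :=
  [multinom (F i.+1 - F i)%N | i < n].

Lemma pref_mnm_of_pref F l : F 0%N = 0%N ->
  (forall i : 'I_n, (F i <= F i.+1)%N) -> (l <= n)%N -> pref (mnm_of_pref F) l = F l.
Proof.
move=> F0 leF; elim: l => [|l IHl] lt_ln; first by rewrite pref0.
have := prefS (mnm_of_pref F) (Ordinal lt_ln); rewrite /= => ->.
rewrite IHl ?(ltnW lt_ln) // mnmE /= subnKC //.
exact: (leF (Ordinal lt_ln)).
Qed.

(** Among exponents of equal degree this is the Borel order: v arises from w by moving units to
    smaller indices. *)
Definition dominates w v : Prop := forall l, (l <= n)%N -> (pref w l <= pref v l)%N.

Definition Bgen b w v : Prop :=
  [/\ forall i, (v i <= b i)%N, dominates w v & mdeg v = mdeg w].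

Definition trunc b m : 'X_{1..n} := [multinom minn (m i) (b i) | i < n].

(** A b-bounded p divides m exactly when it divides [trunc b m], so only the degree of a divisor
    remains to be adjusted. *)
Lemma Bgen_belowP b w m :
  (exists2 p, Bgen b w p & (p <= m)%MM) <-> dominates w (trunc b m).
Proof.
split=> [[p [le_pb dom_p _] /mnm_lepP le_pm] l le_ln|dom].
  apply: leq_trans (dom_p l le_ln) _; apply: leq_pref => i.
  by rewrite mnmE leq_min le_pm le_pb.
(* Capping the prefix sums at |w| makes the degree exactly |w|; the increments only shrink, so the
   result still divides [trunc b m]. *)
pose F l := minn (mdeg w) (pref (trunc b m) l).
have F0 : F 0%N = 0%N by rewrite /F pref0 minn0.
have FS (i : 'I_n) : (F i <= F i.+1 <= F i + trunc b m i)%N.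
  by rewrite /F prefS; lia.
have FE l : (l <= n)%N -> pref (mnm_of_pref F) l = F l.
  by apply: pref_mnm_of_pref => // i; case/andP: (FS i).
have le_p (i : 'I_n) : (mnm_of_pref F i <= minn (m i) (b i))%N.
  by have := FS i; rewrite !mnmE; lia.
exists (mnm_of_pref F); last first.
  by apply/mnm_lepP => i; have := le_p i; rewrite leq_min => /andP[].
split=> [i|l le_ln|]; first by have := le_p i; rewrite leq_min => /andP[].
  rewrite FE // leq_min dom // andbT -pref_mdeg.
  rewrite /pref big_mkcond [leqRHS]big_mkcond /=.
  by apply: leq_sum => i _; rewrite ltn_ord; case: ifP.
rewrite -pref_mdeg FE //; apply/minn_idPl.
by rewrite -pref_mdeg; apply: dom.
Qed.

Lemma Bgen_le_eq b w p v : Bgen b w p -> Bgen b w v -> (p <= v)%MM -> p = v.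
Proof.
move=> [_ _ dp] [_ _ dv] le_pv.
have : mdeg (v - p)%MM = 0%N by have := submK le_pv => /(congr1 mdeg); rewrite mdegD; lia.
by move/eqP; rewrite mdeg_eq0 => /eqP E; rewrite -[RHS](submK le_pv) E add0m.
Qed.

Lemma Bgen_refl b w : (forall i, (w i <= b i)%N) -> Bgen b w w.
Proof. by split. Qed.

(** The additive form avoids truncated subtraction: for i < j the move raises by one exactly the
    prefix sums with i < l <= j. *)
Lemma prefMove m (i j : 'I_n) l : (U_(j) <= m)%MM ->
  (pref (U_(i) + m - U_(j))%MM l + (j < l) = pref m l + (i < l))%N.
Proof.
move=> le_jm; have le_j : (U_(j) <= U_(i) + m)%MM.
  exact: lepm_trans le_jm (lem_addl _ _).
by have := congr1 (pref^~ l) (submK le_j); rewrite !prefD !prefU; lia.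
Qed.

Lemma Bgen_move b w v (i j : 'I_n) : Bgen b w v -> (i < j)%N -> (U_(j) <= v)%MM ->
  (forall t, ((U_(i) + v - U_(j))%MM t <= b t)%N) -> Bgen b w (U_(i) + v - U_(j))%MM.
Proof.
move=> [_ dom dv] lt_ij le_jv le_b; split=> // [l le_ln|].
  by have := dom l le_ln; have := prefMove i l le_jv; lia.
have := prefMove i n le_jv.
by rewrite !pref_mdeg !ltn_ord; lia.
Qed.

(* Raise u at the first index where u and v differ, and lower it at the first index where u exceeds v. *)
Lemma Bgen_step b u v : (forall i, (u i <= b i)%N) -> Bgen b u v -> u <> v ->
  exists i j : 'I_n, [/\ (i < j)%N, (U_(j) <= u)%MM,
    (forall t, ((U_(i) + u - U_(j))%MM t <= b t)%N)
  & Bgen b (U_(i) + u - U_(j))%MM v].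
Proof.
move=> le_ub [le_vb dom dv] neq_uv.
have [i0 neq0] : exists i, u i != v i.
  apply/existsP; apply: contraT; rewrite negb_exists => /forallP E.
  by case: neq_uv; apply/mnmP => i; apply/eqP/negbNE/E.
case: (@arg_minnP _ i0 (fun i => u i != v i) val neq0) => i neq_i min_i.
have eq_lt (t : 'I_n) : (t < i)%N -> u t = v t.
  by rewrite ltnNge => nle; apply/eqP; apply: contraNT nle => /min_i.
have eq_pref : pref u i = pref v i by apply: eq_bigr => t /eq_lt.
have lt_i : (u i < v i)%N.
  rewrite ltn_neqAle neq_i /=.
  by have := dom i.+1 (ltn_ord i); rewrite !prefS eq_pref leq_add2l.
have [j0 gt0] : exists j, (v j < u j)%N.
  apply/existsP; apply: contraT; rewrite negb_exists => /forallP E.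
  suff : (mdeg u < mdeg v)%N by rewrite dv ltnn.
  rewrite !mdegE (bigD1 i) //= [ltnRHS](bigD1 i) //= -addSn leq_add //.
  by apply: leq_sum => t _; rewrite leqNgt.
case: (@arg_minnP _ j0 (fun j => (v j < u j)%N) val gt0) => j gt_j min_j.
have lt_ij : (i < j)%N.
  rewrite ltn_neqAle leqNgt; apply/andP; split.
    by apply/eqP => /val_inj E; move: gt_j lt_i; rewrite E; lia.
  by apply/negP => /eq_lt E; move: gt_j; rewrite E ltnn.
have le_ju : (U_(j) <= u)%MM.
  by apply/mnm_lepP => t; rewrite mnm1E; case: eqP => //= <-; lia.
(* These are the prefix sums of u that the move raises by one; strictness here keeps v dominant. *)
have gap l : (i < l <= j)%N -> (pref u l < pref v l)%N.
  case/andP=> lt_il le_lj.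
  rewrite /pref (bigD1 i) //= [ltnRHS](bigD1 i) //= -addSn leq_add //.
  apply: leq_sum => t /andP[lt_tl _]; rewrite leqNgt; apply/negP => /min_j.
  by move: lt_tl le_lj => /= ? ? ?; lia.
exists i, j; split=> // [t|].
  rewrite mnmBE mnmDE !mnm1E; have := le_ub t; have := le_vb i.
  by case: eqP => [<-|_]; case: eqP => [Et|_] /=; try lia; rewrite -?Et in lt_ij *; lia.
split=> // [l le_ln|].
  have := prefMove i l le_ju; have := gap l; have := dom l le_ln.
  by case: (ltnP i l) => ?; case: (ltnP j l) => ? /=; lia.
by have := prefMove i n le_ju; rewrite !pref_mdeg !ltn_ord; lia.
Qed.

Lemma BgenD b b' w w' v v' : Bgen b w v -> Bgen b' w' v' ->
  Bgen (fun i => b i + b' i)%N (w + w')%MM (v + v')%MM.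
Proof.
move=> [leb dom dv] [leb' dom' dv']; split=> [i|l le_ln|].
- by rewrite mnmDE leq_add.
- by rewrite !prefD leq_add ?dom ?dom'.
- by rewrite !mdegD dv dv'.
Qed.

(* Integer decomposition: rounding the prefix sums of [w / k.+1] down splits off one summand. *)
Lemma Bgen_split b u k w :
  Bgen (fun i => k.+1 * b i)%N (u *+ k.+1)%MM w ->
  exists v v', [/\ Bgen b u v, Bgen (fun i => k * b i)%N (u *+ k)%MM v'
                 & w = (v + v')%MM].
Proof.
move=> [le_wb dom dw]; pose F l := (pref w l %/ k.+1)%N.
have F0 : F 0%N = 0%N by rewrite /F pref0 div0n.
have leF (i : 'I_n) : (F i <= F i.+1)%N.
  by rewrite /F prefS leq_div2r // leq_addr.
pose v := mnm_of_pref F.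
have FE l : (l <= n)%N -> pref v l = F l by apply: pref_mnm_of_pref.
have vE i : v i = (F i.+1 - F i)%N by rewrite mnmE.
(* With remainders r, r' <= k one has w_i = (k+1) v_i + r' - r, so w_i - v_i = k v_i + r' - r. If
   v_i < b_i, use r' - r <= k; if v_i = b_i, the bound on w_i forces r' <= r. *)
have bds (i : 'I_n) : [/\ (v i <= w i)%N, (v i <= b i)%N & (w i - v i <= k * b i)%N].
  have := le_wb i; rewrite vE /F prefS.
  have := divn_eq (pref w i) k.+1; have := ltn_pmod (pref w i) (ltn0Sn k).
  have := divn_eq (pref w i + w i) k.+1; have := ltn_pmod (pref w i + w i) (ltn0Sn k).
  have := leF i; rewrite /F prefS.
  move: (_ %/ _)%N (_ %/ _)%N (_ %% _)%N (_ %% _)%N => q q' r r'.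
  by move=> *; split; nia.
have le_vw : (v <= w)%MM by apply/mnm_lepP => i; case: (bds i).
have wE : w = (v + (w - v))%MM by rewrite addmC submK.
(* If q and r are the quotient and remainder of the prefix sum of w, then q is at least that of u,
   and the rest is k q + r. *)
have bdF l : (l <= n)%N ->
    (pref u l <= pref v l /\ k * pref u l <= pref (w - v)%MM l)%N.
  move=> le_ln; have := dom l le_ln; have := congr1 (pref^~ l) wE.
  rewrite prefMn prefD FE // /F.
  have := divn_eq (pref w l) k.+1; have := ltn_pmod (pref w l) (ltn0Sn k).
  move: (_ %/ _)%N (_ %% _)%N => q r *; split; nia.
have du : (mdeg w = k.+1 * mdeg u)%N by rewrite dw -!pref_mdeg prefMn.
have dv : mdeg v = mdeg u by rewrite -pref_mdeg FE // /F pref_mdeg du mulKn.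
exists v, (w - v)%MM; split=> //.
  by split=> // [i|l /bdF[]//]; case: (bds i).
split=> [i|l le_ln|]; first by rewrite mnmBE; case: (bds i).
  by rewrite prefMn; case: (bdF l le_ln).
rewrite -[RHS]pref_mdeg prefMn pref_mdeg.
by have := congr1 mdeg wE; rewrite mdegD; nia.
Qed.

End PrefixSums.

(** * Products, powers and colons of monomial ideals *)

Section MonomialIdealFacts.

Context {K : fieldType} {n : nat}.

Local Notation S := {mpoly K[n]}.

Implicit Types (I J : S -> Prop) (M D : 'X_{1..n} -> Prop) (m g : 'X_{1..n}).

Lemma mon_gen0 M : mon_gen M (0 : S).
Proof. by apply/mon_genP => m; rewrite msupp0 in_nil. Qed.

Lemma mon_genD M (f h : S) : mon_gen M f -> mon_gen M h -> mon_gen M (f + h).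
Proof.
move=> /mon_genP Mf /mon_genP Mh; apply/mon_genP => m /msuppD_le.
by rewrite mem_cat => /orP[/Mf|/Mh].
Qed.

Lemma mon_genM M (f h : S) : mon_gen M h -> mon_gen M (f * h).
Proof.
move=> /mon_genP Mh; apply/mon_genP => m /msuppM_le /allpairsP[[p q] /= [_ /Mh[g Mg le_gq] ->]].
by exists g => //; apply: lepm_trans le_gq (lem_addl _ _).
Qed.

Lemma mon_gen_sum M (T : eqType) (s : seq T) (F : T -> S) :
  (forall x, x \in s -> mon_gen M (F x)) -> mon_gen M (\sum_(x <- s) F x).
Proof.
move=> MF; rewrite big_seq; elim/big_ind: _ => // [|f h]; first exact: mon_gen0.
exact: mon_genD.
Qed.

Lemma ideal_mul_mon_gen I J M D : same_set I (mon_gen M) -> same_set J (mon_gen D) ->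
  same_set (ideal_mul I J)
    (mon_gen (fun m => exists g h, [/\ M g, D h & m = (g + h)%MM])).
Proof.
move=> IM JD f; split=> [[s Is ->]|[s Ms ->]].
  apply: mon_gen_sum => p /Is[a [b [/IM Ma /JD Db ->]]]; apply: mon_genM.
  apply/mon_genP => m /msuppM_le /allpairsP[[x y] /= [xa yb ->]].
  have [g Mg le_gx] := (mon_genP _ _).1 Ma _ xa.
  have [h Dh le_hy] := (mon_genP _ _).1 Db _ yb.
  exists (g + h)%MM; first by exists g, h.
  by apply/mnm_lepP => i; rewrite !mnmDE leq_add //; apply/mnm_lepP.
exists s => // p /Ms[m [g [h [Mg Dh ->]]] ->].
exists 'X_[g], 'X_[h]; rewrite mpolyXD; split=> //.
  by apply/IM/mon_genX; exists g => //; apply: lepm_refl.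
by apply/JD/mon_genX; exists h => //; apply: lepm_refl.
Qed.

Lemma eq_mon_gen M D : (forall m, M m <-> D m) -> same_set (mon_gen M) (mon_gen D : S -> Prop).
Proof.
by move=> MD f; rewrite !mon_genP; split=> Hf m /Hf[g /MD]; exists g.
Qed.

Lemma ideal_pow_max_ideal j :
  same_set (ideal_pow (@max_ideal K n) j) (mon_gen (fun m => mdeg m = j)).
Proof.
have maxE : same_set (@max_ideal K n) (mon_gen (fun m => mdeg m = 1%N)).
  move=> f; split=> [[s Xs ->]|[s Xs ->]]; exists s => // p /Xs.
    by case=> i ->; exists U_(i)%MM; rewrite ?mdeg1.
  by case=> m /eqP/mdeg1P[i /eqP->] ->; exists i.
elim: j => [|j IHj] f.
  by split=> // _; apply/mon_genP => m _; exists 0%MM; [exact: mdeg0 | by apply/mnm_lepP => i; rewrite mnm0E].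
rewrite /= (ideal_mul_mon_gen maxE IHj); apply: eq_mon_gen => m; split.
  by case=> g [h [dg dh ->]]; rewrite mdegD dg dh.
move=> dm; have [i mi] : exists i, m i != 0%N.
  apply/existsP; apply: contraT; rewrite negb_exists => /forallP m0.
  by move: dm; rewrite mdegE big1 // => i _; apply/eqP/negbNE/m0.
have le_im : (U_(i) <= m)%MM by rewrite lep1mP.
exists U_(i)%MM, (m - U_(i))%MM; rewrite mdeg1 addmC submK //; split=> //.
by have := congr1 mdeg (submK le_im); rewrite mdegD mdeg1; lia.
Qed.

(** Multiplication by a monomial only translates the support, so no terms cancel and each monomial
    of f can be tested separately. *)
Lemma ideal_colon_mon_gen I J M D (f : S) :
  same_set I (mon_gen M) -> same_set J (mon_gen D) ->
  ideal_colon I J f <->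
  forall m, m \in msupp f -> forall g, D g -> exists2 h, M h & (h <= m + g)%MM.
Proof.
move=> IM JD; split=> [If m mf g Dg|Mf a /JD[s Ds ->]].
  have Jg : J 'X_[g] by apply/JD/mon_genX; exists g => //; apply: lepm_refl.
  apply: ((mon_genP _ _).1 ((IM _).1 (If _ Jg))).
  by rewrite (perm_mem (msuppMX _ _)) addmC map_f.
apply/IM; rewrite mulr_sumr; apply: mon_gen_sum => p /Ds[g Dg ->].
rewrite mulrCA; apply: mon_genM; apply/mon_genP => m.
by rewrite (perm_mem (msuppMX _ _)) => /mapP[k kf ->]; rewrite addmC; apply: Mf.
Qed.

End MonomialIdealFacts.

(** * Generators and powers of principal bounded strongly stable ideals *)

Section PrincipalStable.

Context {K : fieldType} {n : nat}.

Local Notation S := {mpoly K[n]}.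

Implicit Types (c : 'rV[int]_n) (u v w m : 'X_{1..n}).

(** The bound in natural numbers; [absz] loses nothing when c_i >= 0. *)
Definition nbound c (i : 'I_n) : nat := absz (c 0 i).

Lemma boundedE c m : (forall i, 0 <= c 0 i) ->
  bounded c m <-> forall i, (m i <= nbound c i)%N.
Proof.
move=> c_ge0; rewrite /bounded /vle /nbound.
by split=> H i; have := H i; have := c_ge0 i; rewrite mxE; lia.
Qed.

(** All elements of [Bgen b w] have the same degree, so none properly divides another. *)
Lemma minmon_Bgen b w v : minmon (mon_gen (Bgen b w) : S -> Prop) v <-> Bgen b w v.
Proof.
split=> [[/mon_genX[g Bg le_gv] min_v]|Bv].
  suff <- : g = v by [].
  by apply: min_v => //; apply/mon_genX; exists g => //; apply: lepm_refl.
split=> [|g /mon_genX[p Bp le_pg] le_gv].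
  by apply/mon_genX; exists v => //; apply: lepm_refl.
have E : p = v by apply: (Bgen_le_eq Bp Bv); apply: lepm_trans le_gv.
apply/mnmP => i; apply/eqP; rewrite eqn_leq (mnm_lepP le_gv) /=.
by rewrite -{1}E (mnm_lepP le_pg).
Qed.

Lemma mingens_mon_gen_Bgen b w v :
  mingens (mon_gen (Bgen b w) : S -> Prop) v <-> Bgen b w v.
Proof. by rewrite mingensE ?minmon_Bgen //; exists (Bgen b w). Qed.

Lemma strongly_stable_Bgen c w : (forall i, 0 <= c 0 i) ->
  strongly_stable c (mon_gen (Bgen (nbound c) w) : S -> Prop).
Proof.
move=> c_ge0; split=> [|v|v i j]; first by exists (Bgen (nbound c) w).
  by rewrite mingens_mon_gen_Bgen boundedE // => -[].
rewrite mingens_mon_gen_Bgen boundedE // => Bv lt_ij le_jv le_c.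
apply/mon_genX; exists (U_(i) + v - U_(j))%MM; last exact: lepm_refl.
exact: Bgen_move.
Qed.

(** Induction on the total prefix-sum deficit of u against v: a move from [Bgen_step] stays in I by
    stability and lowers the deficit. *)
Lemma strongly_stable_mem_Bgen c (I : S -> Prop) u v : (forall i, 0 <= c 0 i) ->
  strongly_stable c I -> I 'X_[u] -> bounded c u -> Bgen (nbound c) u v -> I 'X_[v].
Proof.
move=> c_ge0 stI.
have [d] := ubnP (\sum_(l < n) (pref v l - pref u l))%N.
elim: d u => // d IHd u lt_d Iu bu Bv.
have [<- //|neq_uv] := classic (u = v).
have [i [j [lt_ij le_ju bu' Bv']]] := Bgen_step ((boundedE _ c_ge0).1 bu) Bv neq_uv.
have {}bu' := (boundedE _ c_ge0).2 bu'.
have Iu' : I 'X_[(U_(i) + u - U_(j))%MM] by apply: strongly_stable_move stI _ _ _ _.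
have [_ dom _] := Bv'.
apply: IHd Iu' bu' Bv'.
apply: leq_trans (_ : _ < \sum_(l < n) (pref v l - pref u l))%N lt_d.
have mv l := prefMove i l le_ju.
(* The term at l = j drops strictly, and no other term grows. *)
rewrite (bigD1 j) //= [ltnRHS](bigD1 j) //= -addSn leq_add //.
  by have := mv j; have := dom j (ltnW (ltn_ord j)); rewrite ltnn lt_ij; lia.
by apply: leq_sum => l _; have := mv l; case: ltnP => ?; case: ltnP => ? /=; lia.
Qed.

(** Leastness of [Bb] gives one inclusion, reachability of every [Bgen] element by moves the
    other. *)
Lemma BbE c w : (forall i, 0 <= c 0 i) -> bounded c w ->
  same_set (Bb K c w) (mon_gen (Bgen (nbound c) w)).
Proof.
move=> c_ge0 cw f; split.
  apply: Bb_least f; first exact: strongly_stable_Bgen.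
  apply/mon_genX; exists w; last exact: lepm_refl.
  exact/Bgen_refl/boundedE.
have stB := strongly_stable_Bb K cw.
have [/monomial_idealP[BE Bup] _ _] := stB.
move/mon_genP => Mf; apply/BE => m /Mf[g Bg]; apply: Bup.
exact: strongly_stable_mem_Bgen c_ge0 stB (@mem_Bb K n c w) cw Bg.
Qed.

Lemma nboundMn c k i : nbound (c *+ k) i = (k * nbound c i)%N.
Proof. by rewrite /nbound mulmxnE -mulr_natr abszM mulnC natz. Qed.

Lemma eq_Bgen b b' w v : b =1 b' -> Bgen b w v <-> Bgen b' w v.
Proof. by move=> Eb; split=> -[le_vb ? ?]; split=> // i; rewrite ?Eb // -Eb. Qed.

(** [BgenD] puts products of generators into the right-hand side; [Bgen_split] factors each
    generator there. *)
Lemma ideal_pow_Bgen c u (I : S -> Prop) k :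
  same_set I (mon_gen (Bgen (nbound c) u)) ->
  same_set (ideal_pow I k) (mon_gen (Bgen (nbound (c *+ k)) (u *+ k)%MM)).
Proof.
move=> IE; elim: k => [|k IHk] f.
  split=> // _; apply/mon_genP => m _; exists 0%MM; last by apply/mnm_lepP => i; rewrite mnm0E.
  by rewrite mulm0n; apply: Bgen_refl => i; rewrite mnm0E.
rewrite /= (ideal_mul_mon_gen IE IHk); apply: eq_mon_gen => m; split.
  case=> g [h [Bg Bh ->]]; rewrite mulmS.
  apply: (eq_Bgen _ _ _).1 (BgenD Bg Bh) => i.
  by rewrite !nboundMn mulSn.
rewrite (eq_Bgen _ _ (nboundMn c k.+1)) => /Bgen_split[g [h [Bg Bh ->]]].
by exists g, h; split=> //; apply: (eq_Bgen _ _ (nboundMn c k)).2.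
Qed.

End PrincipalStable.

(** * Colons by powers of the maximal ideal, and the saturation number *)

Section Saturation.

Context {n : nat}.

Implicit Types (b : 'I_n.+1 -> nat) (w m g f v : 'X_{1..n.+1}) (j l : nat).

(** The truncated difference b_i - m_i is the room left at i, and g contributes at most that. *)
Lemma pref_truncD b m g l :
  pref (trunc b (m + g)%MM) l =
  (pref (trunc b m) l + \sum_(i < n.+1 | i < l) minn (g i) (b i - m i))%N.
Proof.
by rewrite /pref -big_split; apply: eq_bigr => i _; rewrite !mnmE /=; lia.
Qed.

(* A sum of terms min(g_i, s_i) with |g| = j is smallest when g is concentrated in one variable. *)
Lemma colon_BgenP b w j m :
  (forall g, mdeg g = j -> exists2 h, Bgen b w h & (h <= m + g)%MM) <->
  (forall l, (l <= n)%N -> (pref w l <= pref (trunc b m) l)%N) /\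
  (forall i, (mdeg w <= mdeg (trunc b m) + minn j (b i - m i))%N).
Proof.
split=> [Cm|[dom deg] g dg].
  (* Pure powers x_i^j suffice as tests: the last variable leaves the proper prefixes l <= n
     unchanged, and each i gives a degree condition. *)
  have {Cm}Cm i : dominates w (trunc b (m + U_(i) *+ j)%MM).
    by apply/Bgen_belowP/Cm; rewrite mdegMn mdeg1 mul1n.
  split=> [l le_ln|i].
    have := Cm ord_max l (leqW le_ln); rewrite pref_truncD big1 ?addn0 // => i lt_il.
    rewrite mulmnE mnm1E; case: eqP => [Ei|_]; last by rewrite mul0n min0n.
    by move: lt_il; rewrite -Ei /=; lia.
  have := Cm i n.+1 (leqnn _); rewrite pref_truncD !pref_mdeg.
  rewrite (bigD1 i) ?ltn_ord //= big1 => [|t /andP[_ /negPf nti]].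
    by rewrite addn0 mulmnE mnm1E eqxx mul1n.
  by rewrite mulmnE mnm1E eq_sym nti mul0n min0n.
apply/Bgen_belowP => l; rewrite pref_truncD leq_eqVlt => /predU1P[->|/dom]; last first.
  by move=> h; apply: leq_trans h (leq_addr _ _).
rewrite !pref_mdeg.
(* Either g fills the room at some i, whose term alone suffices, or nothing is cut off and the sum
   is j. *)
have [i le_i] : exists i, (minn j (b i - m i) <= \sum_(t < n.+1 | t < n.+1) minn (g t) (b t - m t))%N.
  have [/existsP[i le_i]|] := boolP [exists i, (b i - m i <= g i)%N].
    exists i; rewrite (bigD1 i) ?ltn_ord //=; lia.
  rewrite negb_exists => /forallP lt_g; exists ord0.
  rewrite (_ : (\sum_(t < n.+1 | _) _)%N = j); first exact: geq_minl.
  rewrite -dg mdegE; apply: eq_big => [t|t _]; first by rewrite ltn_ord.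
  by have := lt_g t; rewrite -ltnNge => /ltnW/minn_idPl.
by apply: leq_trans (deg i) _; rewrite leq_add2l.
Qed.

(** For l > 0, such an f is a monomial of J : 𝔪^l outside J : 𝔪^(l-1), where J is generated by
    [Bgen b w]. *)
Definition socle_deg b w l : Prop :=
  exists f, [/\ forall t, (t <= n)%N -> (pref w t <= pref f t)%N,
    (mdeg f + l)%N = mdeg w & forall i, (f i + l <= b i)%N].

Lemma trunc_id b m : (forall i, (m i <= b i)%N) -> trunc b m = m.
Proof. by move=> le_mb; apply/mnmP => i; rewrite mnmE; apply/minn_idPl. Qed.

Lemma colon_Bgen_stableP b w j :
  (forall m, (forall g, mdeg g = j -> exists2 h, Bgen b w h & (h <= m + g)%MM) <->
             (forall g, mdeg g = j.+1 -> exists2 h, Bgen b w h & (h <= m + g)%MM)) <->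
  ~ socle_deg b w j.+1.
Proof.
split=> [stab [f [dom df le_fb]]|nS m]; rewrite ?colon_BgenP.
  have fE : trunc b f = f by apply: trunc_id => i; have := le_fb i; lia.
  have := stab f; rewrite !colon_BgenP fE => -[_ []].
    by split=> // i; have := le_fb i; lia.
  by move=> _ /(_ ord0); have := le_fb ord0; lia.
split=> -[dom deg]; split=> // i; first by have := deg i; lia.
rewrite leqNgt; apply/negP => lt_i; apply: nS.
(* Failure for j at i, with success for j+1, forces the minimum at i to be j, so every t must have
   room for j+1. *)
have le_b t : (m t + j.+1 <= b t)%N by have := deg t; have := deg i; lia.
have mE : trunc b m = m by apply: trunc_id => t; have := le_b t; lia.
rewrite mE in dom deg lt_i.
by exists m; split=> //; have := deg i; lia.
Qed.

(** The correspondence is v = f x_n^l: a power of the last variable changes the degree but no proper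
    prefix sum. *)
Lemma socle_degP b w l :
  socle_deg b w l <->
  exists v, [/\ Bgen b w v, (U_(ord_max) *+ l <= v)%MM
    & forall i, ((v - U_(ord_max) *+ l)%MM i + l <= b i)%N].
Proof.
have prefX t : (t <= n)%N -> pref (U_(@ord_max n) *+ l)%MM t = 0%N.
  by move=> le_tn; rewrite prefMn prefU /= ltnNge le_tn muln0.
split=> [[f [dom df le_fb]]|[v [[le_vb dom dv] le_lv le_b]]].
  exists (f + U_(ord_max) *+ l)%MM; split; last 2 first.
  - exact: lem_addl.
  - by move=> i; rewrite addmK.
  have dv : mdeg (f + U_(ord_max) *+ l)%MM = mdeg w.
    by rewrite mdegD mdegMn mdeg1 mul1n.
  split=> // [i|t].
    rewrite mnmDE mulmnE; apply: leq_trans (le_fb i); rewrite leq_add2l mnm1E.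
    by case: eqP => _; rewrite ?mul1n ?mul0n.
  rewrite leq_eqVlt => /predU1P[->|lt_tn]; first by rewrite !pref_mdeg dv.
  by rewrite prefD (leq_trans (dom t lt_tn)) ?leq_addr.
have vE := submK le_lv; exists (v - U_(ord_max) *+ l)%MM; split=> // [t le_tn|].
  have := dom t (leqW le_tn); rewrite -[in pref v t]vE prefD prefX ?addn0 //.
by rewrite -dv -[in RHS]vE mdegD mdegMn mdeg1 mul1n.
Qed.

Lemma is_sat_Bgen (K : fieldType) b w (I : {mpoly K[n.+1]} -> Prop) s :
  same_set I (mon_gen (Bgen b w)) -> is_max (socle_deg b w) s -> is_sat I s.
Proof.
move=> IE [Qs max_s].
have stableP j : same_set (ideal_colon I (ideal_pow (@max_ideal K n.+1) j))
    (ideal_colon I (ideal_pow (@max_ideal K n.+1) j.+1)) <-> ~ socle_deg b w j.+1.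
  have colonP i (f : {mpoly K[n.+1]}) := ideal_colon_mon_gen f IE (@ideal_pow_max_ideal K n.+1 i).
  rewrite -colon_Bgen_stableP; split=> [stab m|stab f].
    have := stab 'X_[m]; rewrite !colonP msuppX => {}stab.
    split=> Cf.
      by apply: stab.1; rewrite ?mem_head // => m'; rewrite inE => /eqP->.
    by apply: stab.2; rewrite ?mem_head // => m'; rewrite inE => /eqP->.
  by rewrite !colonP; split=> Cf m /Cf /stab.
split=> [|j /stableP nQ]; first by apply/stableP => /max_s; rewrite ltnn.
rewrite leqNgt; apply/negP => lt_js; apply: nQ.
(* [socle_deg] is downward closed: the same v serves for every smaller exponent, since its last
   coordinate only needs v_n <= b_n. *)
move: Qs => /socle_degP[v [Bv le_sv le_b]]; apply/socle_degP; exists v.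
have le_v : (s <= v ord_max)%N by move/mnm_lepP/(_ ord_max): le_sv; rewrite mulmnE mnm1E eqxx mul1n.
split=> // [|i].
  apply/mnm_lepP => t; rewrite mulmnE mnm1E; case: eqP => [<-|_]; last by [].
  by rewrite mul1n (leq_trans lt_js).
have := le_b i; rewrite !mnmBE !mulmnE mnm1E.
by case: eqP => [<-|_] /=; lia.
Qed.

End Saturation.

Theorem corollary3p3 (K : fieldType) (n : nat) (c : 'rV[int]_n.+1)
    (c_ge0 : forall i, 0 <= c 0 i) (u : 'X_{1..n.+1}) (c_u : bounded c u)
    (k : nat) (k_gt0 : (0 < k)%N) :
  exists s : nat,
    is_sat (ideal_pow (Bb K c u) k) s /\
    is_max (fun l : nat =>
      exists v : 'X_{1..n.+1},
        [/\ mingens (Bb K (c *+ k) (u *+ k)%MM) v,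
            (U_(ord_max) *+ l <= v)%MM
          & vle (Deg (v - U_(ord_max) *+ l)%MM)
                (c *+ k - evec n.+1 *+ l)]) s.
Proof.
have ck_ge0 i : 0 <= (c *+ k) 0 i by rewrite mulmxnE mulrn_wge0.
have ck_u : bounded (c *+ k) (u *+ k)%MM.
  apply/boundedE => // i; rewrite nboundMn mulmnE mulnC leq_mul //.
  exact: (boundedE u c_ge0).1.
pose b := nbound (c *+ k).
have BE := @BbE K _ _ _ ck_ge0 ck_u.
have IkE := ideal_pow_Bgen k (@BbE K _ _ _ c_ge0 c_u).
(* The maximum exists: u^k itself witnesses l = 0, and l never exceeds its degree. *)
have [|l [f [_ df _]]|s max_s] :=
  @bounded_pred_max (socle_deg b (u *+ k)%MM) (mdeg (u *+ k)%MM).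
- exists (u *+ k)%MM; rewrite addn0; split=> // i; rewrite addn0.
  exact: (boundedE _ ck_ge0).1.
- by rewrite -df leq_addl.
exists s; split; first exact: is_sat_Bgen IkE max_s.
have monB : monomial_ideal (Bb K (c *+ k) (u *+ k)%MM) by exists (Bgen b (u *+ k)%MM).
have minE v : mingens (Bb K (c *+ k) (u *+ k)%MM) v <-> Bgen b (u *+ k)%MM v.
  rewrite mingensE // -(minmon_Bgen (K := K)) /minmon BE.
  by split=> -[Bv min_v]; split=> // g /BE; apply: min_v.
(* The right-hand side may be negative over the integers, so l is moved across before passing to
   natural numbers. *)
have leE l (v : 'X_{1..n.+1}) : vle (Deg v) (c *+ k - evec n.+1 *+ l) <->
    forall i, (v i + l <= b i)%N.
  have rE i : (c *+ k - evec n.+1 *+ l) 0 i = (c *+ k) 0 i - l%:Z.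
    by rewrite [LHS]mxE; congr (_ + _); rewrite mxE mulmxnE mxE natz.
  have dE i : Deg v 0 i = (v i)%:Z by rewrite mxE.
  by split=> H i; have := H i; have := ck_ge0 i; rewrite ?rE ?dE /b /nbound;
    move: ((c *+ k) 0 i) => z; lia.
suff QE l : socle_deg b (u *+ k)%MM l <-> exists v : 'X_{1..n.+1},
    [/\ mingens (Bb K (c *+ k) (u *+ k)%MM) v, (U_(ord_max) *+ l <= v)%MM
      & vle (Deg (v - U_(ord_max) *+ l)%MM) (c *+ k - evec n.+1 *+ l)].
  by case: max_s => /QE Qs le_s; split=> // l /QE/le_s.
rewrite socle_degP; split=> -[v [Bv le_v le_b]]; exists v; split=> //.
- exact/minE.
- exact/leE.
- exact/minE.
- exact/leE.
Qed.
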